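(* Let $\alpha>0$, $\theta\in(0,\pi/2)$, $d=3$ and $l\in\mathbb{N}$, $l>0$. Then $\mathcal{C}_0^\infty(\overline{\mathbb{R}_+^2})\cap\mathrm{dom}\,Q^{[l]}_{\alpha,\Gamma_\theta}\subset\mathcal{C}_{0,0}^\infty(\overline{\mathbb{R}_+^2})$.
   Context: $\mathbb{R}^2_+:=\mathbb{R}_+\times\mathbb{R}$ with coordinates $(r,z)$, $r>0$. For $d=3$ and $l>0$ the quadratic form $Q^{[l]}_{\alpha,\Gamma_\theta}$ in $L^2(\mathbb{R}_+^2,r\,dr\,dz)$ is $$Q^{[l]}_{\alpha,\Gamma_\theta}[u]:=\int_{\mathbb{R}_+^2}\Big(|\partial_ru|^2+|\partial_zu|^2+\frac{l^2}{r^2}|u|^2\Big)r\,dr\,dz-\alpha\int_{\mathbb{R}_+}|u(s\sin\theta,s\cos\theta)|^2s\sin\theta\,ds,$$ with $\mathrm{dom}\,Q^{[l]}_{\alpha,\Gamma_\theta}=\{u:u,\partial_ru,\partial_zu,r^{-1}u\in L^2(\mathbb{R}_+^2,r\,dr\,dz)\}$. $\mathcal{C}_0^\infty(\overline{\mathbb{R}_+^2})$ is the space of infinitely differentiable functions with compact support in $\overline{\mathbb{R}_+^2}$ and $\mathcal{C}_{0,0}^\infty(\overline{\mathbb{R}_+^2}):=\{u\in\mathcal{C}_0^\infty(\overline{\mathbb{R}_+^2}):u|_{r=0}=0\}$. *)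

(* Defs.v *)
From HB Require Import structures.
From mathcomp Require Import all_boot all_order all_algebra.
From mathcomp Require Import complex.
From mathcomp Require Import all_classical all_reals all_analysis.

Set Implicit Arguments.
Unset Strict Implicit.
Unset Printing Implicit Defensive.

Import Order.TTheory GRing.Theory Num.Theory.
Import numFieldNormedType.Exports.

Local Open Scope classical_set_scope.
Local Open Scope ring_scope.
Local Open Scope complex_scope.

Section HalfPlane.
Context {R : realType}.

(* Points are pairs (r, z).  Functions on the (closed) half-plane are
   represented by total functions on R * R; their values at r < 0 (resp.
   r <= 0, for functions on the open half-plane) are never used. *)
Definition half_plane : set (R * R) := [set x | 0 < x.1].

Definition closed_half_plane : set (R * R) := [set x | 0 <= x.1].

Definition re_part (u : R * R -> R[i]) : R * R -> R := fun x => complex.Re (u x).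
Definition im_part (u : R * R -> R[i]) : R * R -> R := fun x => complex.Im (u x).

Definition dir_r : R * R := (1, 0).
Definition dir_z : R * R := (0, 1).

Fixpoint C_k (k : nat) (f : R * R -> R) : Prop :=
  continuous f /\
  (if k is k'.+1 then
     forall v, v = dir_r \/ v = dir_z ->
       (forall x, derivable f x v) /\ C_k k' ('D_v f)
   else True).

Definition C_infty (f : R * R -> R) : Prop := forall k, C_k k f.

(* Smoothness up to the boundary r = 0: on the closed half-plane, u is the
   restriction of an infinitely differentiable function on the plane. *)
Definition smooth_closed_half_plane (u : R * R -> R[i]) : Prop :=
  exists2 v : R * R -> R[i],
    C_infty (re_part v) /\ C_infty (im_part v) &
    forall x, closed_half_plane x -> u x = v x.

(* The support may touch the line r = 0. *)
Definition C0infty_closed : set (R * R -> R[i]) :=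
  [set u | smooth_closed_half_plane u /\
           compact (closure (closed_half_plane `&` [set x | u x != 0]))].

Definition C00infty_closed : set (R * R -> R[i]) :=
  [set u | C0infty_closed u /\ forall z : R, u (0, z) = 0].

(* The same carrier as R * R, on which the product Borel sigma-algebra is
   inferred in the form expected by Lebesgue measure. *)
Definition borel_plane := (measurableTypeR R * measurableTypeR R)%type.

Definition leb2 : {measure set borel_plane -> \bar R} :=
  (@lebesgue_measure R \x @lebesgue_measure R)%E.

(* L^2 (half_plane, r dr dz): normc is the real-valued modulus, and
   measurability of u is that of its two real components. *)
Definition L2_r : set (R * R -> R[i]) :=
  [set u | [/\ measurable_fun (half_plane : set borel_plane) (re_part u),
               measurable_fun (half_plane : set borel_plane) (im_part u) &
    (\int[leb2]_(x in half_plane)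
       ((Normc.normc (u x) ^+ 2 * x.1)%:E) < +oo)%E]].

Definition test_function : set (R * R -> R) :=
  [set phi | [/\ C_infty phi,
                 compact (closure [set x | phi x != 0]) &
                 closure [set x | phi x != 0] `<=` half_plane]].

(* g = D_v f in the sense of distributions on half_plane; distributional
   derivatives are taken with respect to dr dz, not the weighted measure. *)
Definition weak_derivative (v : R * R) (f g : R * R -> R) : Prop :=
  forall phi, test_function phi ->
    Rintegral leb2 half_plane (fun x => f x * 'D_v phi x) =
    - Rintegral leb2 half_plane (fun x => g x * phi x).

Definition has_weak_derivative_L2 (v : R * R) (u : R * R -> R[i]) : Prop :=
  exists2 g : R * R -> R[i], L2_r g &
    weak_derivative v (re_part u) (re_part g) /\
    weak_derivative v (im_part u) (im_part g).

(* The domain of the form Q^[l]_(alpha, Gamma_theta) is the same for all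
   values of alpha, theta and l > 0; only the form itself depends on them. *)
Definition dom_Q (alpha theta : R) (l : nat) : set (R * R -> R[i]) :=
  [set u | [/\ L2_r u,
               has_weak_derivative_L2 dir_r u,
               has_weak_derivative_L2 dir_z u &
               L2_r (fun x => x.1^-1%:C * u x)]].

End HalfPlane.

(* Main.v *)
(* If u(0, z) <> 0 then, by continuity, |u|^2 is at least some c > 0 on a box
   (0, e) x (z - e, z + e), so the integral of |u / r|^2 r dominates that of
   c / r over this box, which diverges at r = 0. *)

Require Import Defs.
From mathcomp Require Import all_boot all_order all_algebra.
From mathcomp Require Import complex ring lra.
From mathcomp Require Import all_classical all_reals all_analysis measurable_realfun.

Import Order.TTheory GRing.Theory Num.Theory.
Import numFieldNormedType.Exports.

Local Open Scope classical_set_scope.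
Local Open Scope ring_scope.

Lemma measurable_half_plane (R : realType) :
  measurable (half_plane : set (borel_plane (R := R))).
Proof.
have -> : half_plane = `]0 : R, +oo[%classic `*` [set: R].
  by apply/seteqP; split=> x; rewrite /half_plane /= in_itv /= andbT // => -[].
by apply: measurableX.
Qed.

Lemma measurable_box (R : realType) (i j : interval R) :
  measurable ([set` i] `*` [set` j] : set (borel_plane (R := R))).
Proof. by apply: measurableX; exact: measurable_itv. Qed.

Lemma leb2_box (R : realType) (a b a' b' : R) : a <= b -> a' <= b' ->
  leb2 (`]a, b] `*` `]a', b'[) = ((b - a) * (b' - a'))%:E.
Proof.
have len (x y : R) : x <= y ->
    (if (x%:E < y%:E)%E then (y%:E - x%:E)%E else 0%E) = (y - x)%:E.
  by rewrite lte_fin le_eqVlt => /predU1P[->|->]//; rewrite ltxx subrr.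
move=> ab ab'.
rewrite [LHS](@product_measure1E _ _ _ _ R _ lebesgue_measure);
  [|exact: measurable_itv..].
rewrite [X in (X * _)%E]lebesgue_measure_itv [X in (_ * X)%E]lebesgue_measure_itv.
by rewrite /= !len.
Qed.

Lemma integral_box_ge (R : realType) (f : R * R -> R) (c a b a' b' : R) :
  0 <= c -> 0 <= a -> a <= b -> a' <= b' ->
  measurable_fun (half_plane : set (borel_plane (R := R))) f ->
  (forall x, (`]a, b] `*` `]a', b'[) x -> c <= f x) ->
  ((c * ((b - a) * (b' - a')))%:E
     <= \int[leb2]_(x in `]a, b] `*` `]a', b'[) (f x)%:E)%E.
Proof.
move=> c0 a0 ab ab' mf cf.
have mD := @measurable_box R `]a, b] `]a', b'[.
rewrite EFinM -leb2_box // -(@integral_cst _ _ _ _ _ mD).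
apply: ge0_le_integral => //.
apply/measurable_EFinP; apply: measurable_funS mf => //.
  exact: measurable_half_plane.
by move=> x [/=]; rewrite in_itv /= => /andP[+ _] _; exact: le_lt_trans.
Qed.

(* Each dyadic strip e/2^(k+2) < r <= e/2^(k+1) has mass at least c * e. *)
Lemma integral_half_plane_inv_pinfty (R : realType) (f : R * R -> R)
    (z c e : R) : 0 < c -> 0 < e ->
  measurable_fun (half_plane : set (borel_plane (R := R))) f ->
  (forall x, half_plane x -> 0 <= f x) ->
  (forall x, (`]0, e[ `*` `]z - e, z + e[) x -> c / x.1 <= f x) ->
  (\int[leb2]_(x in half_plane) (f x)%:E = +oo)%E.
Proof.
move=> c0 e0 mf f0 cf.
pose b n : R := e / 2 ^+ n.+1.
have b0 n : 0 < b n by rewrite divr_gt0 ?exprn_gt0.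
have bS n : b n = b n.+1 * 2.
  by rewrite /b (exprS 2 n.+1); field; rewrite expf_neq0.
have b0e : b 0%N < e by rewrite /b expr1; lra.
have bdecr n : b n <= b 0%N.
  by elim: n => // n IH; apply: le_trans IH; rewrite (bS n); have := b0 n.+1; lra.
have mh := @measurable_half_plane R.
have boxh n y : `]b n, y] `*` `]z - e, z + e[ `<=` half_plane.
  by move=> x [/=]; rewrite in_itv /= => /andP[+ _] _; exact: lt_trans.
have mfB n y : measurable_fun
    (`]b n, y] `*` `]z - e, z + e[ : set (borel_plane (R := R))) (EFin \o f).
  apply/measurable_EFinP; exact: measurable_funS (boxh n y) mf.
have strips n : ((n%:R * (c * e))%:E <=
    \int[leb2]_(x in `]b n, b 0%N] `*` `](z - e)%R, (z + e)%R[) (f x)%:E)%E.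
  elim: n => [|n IH].
    rewrite mul0r; apply: integral_ge0 => x /boxh; rewrite lee_fin; exact: f0.
  have bn : b n.+1 <= b n by rewrite (bS n); have := b0 n.+1; lra.
  have split_box : `]b n.+1, b 0%N] `*` `]z - e, z + e[ =
      (`]b n.+1, b n] `*` `]z - e, z + e[) `|`
      (`]b n, b 0%N] `*` `]z - e, z + e[).
    apply/seteqP; split=> x; rewrite /setU /= !in_itv /=.
      move=> [/andP[-> ->] ->] /=.
      by case: (leP x.1 (b n)) => _; [left|right].
    move=> [] [/andP[xl xr] ->]; split=> //; apply/andP; split=> //.
      exact: le_trans xr (bdecr n).
    exact: le_lt_trans bn xl.
  rewrite split_box ge0_integral_setU; [|exact: measurable_box..|
    by rewrite -split_box; exact: mfB|
    by rewrite -split_box => x /boxh hx; rewrite lee_fin; exact: f0|].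
    rewrite -natr1 mulrDl mul1r addrC EFinD leeD //.
    have -> : c * e = (c / b n) * ((b n - b n.+1) * ((z + e) - (z - e))).
      by rewrite (bS n); field; rewrite gt_eqF.
    apply: integral_box_ge => //; [by rewrite ltW ?divr_gt0|exact: ltW|lra|].
    move=> x [/= x1 x2]; have := x1; rewrite in_itv /= => /andP[xl xr].
    have x0 : 0 < x.1 by exact: lt_trans xl.
    apply: (@le_trans _ _ (c / x.1)); first by rewrite ler_pM2l // lef_pV2 ?posrE.
    apply: cf; split=> //=; rewrite in_itv /= x0 /=.
    exact: le_lt_trans (le_trans xr (bdecr n)) b0e.
  apply/disj_setPS => x [[/= + _] [/= + _]].
  rewrite !in_itv /= => /andP[_ xr] /andP[xl _].
  by move: (lt_le_trans xl xr); rewrite ltxx.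
apply/eqyP => A A0.
have ce0 : 0 < c * e by exact: mulr_gt0.
apply: le_trans (le_trans (strips (Num.bound (A / (c * e)))) _).
  by rewrite lee_fin -ler_pdivrMr // ltW // archi_boundP // ltW // divr_gt0.
apply: ge0_subset_integral => //; [exact: measurable_box|
  exact/measurable_EFinP].
Qed.

Lemma normc_sqr (R : rcfType) (w : R[i]) :
  Normc.normc w ^+ 2 = complex.Re w ^+ 2 + complex.Im w ^+ 2.
Proof. by case: w => a b /=; rewrite sqr_sqrtr // addr_ge0 // sqr_ge0. Qed.

Theorem lemmaA3 (R : realType) (alpha theta : R) (l : nat)
  (alpha_gt0 : 0 < alpha) (theta_gt0 : 0 < theta) (theta_lt : theta < pi / 2)
  (l_gt0 : (0 < l)%N) :
  C0infty_closed `&` dom_Q alpha theta l `<=` C00infty_closed.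
Proof.
move=> u [uC [_ _ _ [mre mim ifin]]]; split=> // z.
move: ifin; apply: contraPP => uz; apply/negP; rewrite -leNgt leye_eq; apply/eqP.
have [[v [/(_ 0%N)[cre _] /(_ 0%N)[cim _]] uv] _] := uC.
pose N x := re_part v x ^+ 2 + im_part v x ^+ 2.
have N0 : 0 < N (0, z).
  rewrite /N lt0r addr_ge0 ?sqr_ge0 // andbT.
  rewrite paddr_eq0 ?sqr_ge0 // !sqrf_eq0; apply/andP => -[/eqP a0 /eqP b0].
  apply: uz; rewrite uv ?/closed_half_plane //=; apply/eqP.
  by rewrite eq_complex; apply/andP; split; apply/eqP.
have cN : {for (0, z), continuous N}.
  by apply: cvgD; apply: cvgM; (exact: cre || exact: cim).
have /nbhs_ballP[e /= e0 Ne] : \forall x \near (0, z), N (0, z) / 2 < N x.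
  by apply: (cvgr_gt _ cN); lra.
apply: (@integral_half_plane_inv_pinfty _ _ z (N (0, z) / 2) e) => //.
- by rewrite divr_gt0.
- under eq_fun do rewrite normc_sqr.
  apply: measurable_funM; last exact: measurable_funTS measurable_fst.
  by apply: measurable_funD; apply: measurable_funX.
- by move=> x; rewrite /half_plane /= => x0; rewrite mulr_ge0 ?sqr_ge0 ?ltW.
- move=> x [/=]; rewrite !in_itv /= => /andP[x0 x1e] /andP[x2l x2r].
  have /ltW Nx : N (0, z) / 2 < N x.
    apply: Ne; split; rewrite /ball /=; first by rewrite sub0r normrN gtr0_norm.
    by rewrite ltr_norml; apply/andP; split; lra.
  rewrite uv; last exact: ltW.
  rewrite Normc.normcM exprMn !normc_sqr /= expr0n addr0.
  rewrite -/(re_part v x) -/(im_part v x) -/(N x).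
  have -> : x.1^-1 ^+ 2 * N x * x.1 = N x / x.1 by field; rewrite gt_eqF.
  by rewrite ler_pM2r ?invr_gt0.
Qed.
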